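(* Let $\lambda\geq 1$ be an integer and let $L$ be a frequency square of type $F(2\lambda;\lambda,\lambda)$. Then $L$ has a balanced diagonal, unless $\lambda$ is odd and $L$ is equivalent to $A_{2\lambda}$.
   Context: Write $N(k)=\{1,2,\dots,k\}$. Rows and columns of an $n\times n$ array are indexed by $N(n)$, and $L_{i,j}$ denotes the entry of $L$ in cell $(i,j)$. An array is identified with its set of triples $(i,j;L_{i,j})$. A frequency square of type $F(2\lambda;\lambda,\lambda)$ is a $2\lambda\times 2\lambda$ array with entries from $\{1,2\}$ in which each of the two symbols occurs exactly $\lambda$ times in each row and exactly $\lambda$ times in each column. A diagonal of a square array is a set of cells that uses each row and each column exactly once. A diagonal of such a frequency square is balanced if each of the symbols $1,2$ occurs in exactly $\lambda$ of its cells. Two such frequency squares are equivalent if one can be obtained from the other by rearranging rows, rearranging columns, relabelling symbols, and/or taking the transpose. The frequency square $A_{2\lambda}$ is $$A_{2\lambda}=\{(i,j;1),\ (i+\lambda,j+\lambda;1),\ (i,j+\lambda;2),\ (i+\lambda,j;2)\mid i,j\in N(\lambda)\}.$$ *)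

(* Defs.v *)
From mathcomp Require Import all_boot all_fingroup all_algebra.

Set Implicit Arguments.
Unset Strict Implicit.
Unset Printing Implicit Defensive.

(* Arrays are MathComp matrices; rows and columns are indexed from 0, so that
   the ordinal i stands for the index i + 1 of N(n) = {1, ..., n}.  Likewise
   the symbol set {1, 2} is represented by 'I_2. *)
Definition symbol := 'I_2.
Definition sym1 : symbol := ord0.
Definition sym2 : symbol := ord_max.

Definition frequency_square (lam : nat) (L : 'M[symbol]_(2 * lam)) : Prop :=
  forall k : symbol,
    (forall i, #|[set j | L i j == k]| = lam) /\
    (forall j, #|[set i | L i j == k]| = lam).

Definition diagonal (n : nat) (D : {set 'I_n * 'I_n}) : Prop :=
  (forall i, #|[set c in D | c.1 == i]| = 1) /\
  (forall j, #|[set c in D | c.2 == j]| = 1).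

Definition balanced (lam : nat) (L : 'M[symbol]_(2 * lam))
    (D : {set 'I_(2 * lam) * 'I_(2 * lam)}) : Prop :=
  forall k : symbol, #|[set c in D | L c.1 c.2 == k]| = lam.

Definition has_balanced_diagonal (lam : nat) (L : 'M[symbol]_(2 * lam)) : Prop :=
  exists D, diagonal D /\ balanced L D.

(* The operations may be combined in any order and any number of times. *)
Inductive equivalent (n : nat) (L : 'M[symbol]_n) : 'M[symbol]_n -> Prop :=
| equivalent_refl : equivalent L L
| equivalent_rows M (s : 'S_n) : equivalent L M -> equivalent L (row_perm s M)
| equivalent_cols M (s : 'S_n) : equivalent L M -> equivalent L (col_perm s M)
| equivalent_symbols M (s : {perm symbol}) :
    equivalent L M -> equivalent L (map_mx s M)
| equivalent_tr M : equivalent L M -> equivalent L M^T.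

(* Symbol 1 fills the two diagonal lam x lam blocks, symbol 2 the other two. *)
Definition A_square (lam : nat) : 'M[symbol]_(2 * lam) :=
  \matrix_(i, j) if (i < lam) == (j < lam) then sym1 else sym2.

(* Main.v *)
Require Import Defs.
From mathcomp Require Import all_boot all_fingroup all_algebra.
From mathcomp Require Import zify.

Set Implicit Arguments.
Unset Strict Implicit.
Unset Printing Implicit Defensive.

(* Write w(s) for the number of cells (i, s i) with symbol 1.  Cyclic shifts
   average to w = lam, and a transposition changes w by at most 2; so if no
   diagonal is balanced, some permutation (the identity, after permuting
   columns) has w = lam - 1 and becomes w = lam + 1 after composing with a
   transposition (a b).  Since no further transposition may reach w = lam, the
   cells (i, j) and (j, i) are tightly correlated.  The same holds for the
   complement of L with columns a and b exchanged, so L can be attacked from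
   both sides; one finds that rows a and b are complementary, then that every
   row is equal or complementary to row a.  Such squares are exactly those
   equivalent to A; in them w is always even, so they are unbalanced precisely
   when lam is odd. *)

(** * Weights of permutations in a 0/1 array *)

Section Weight.

Variable T : finType.
Implicit Types (L : T -> T -> bool) (s u : {perm T}) (lam : nat).

Definition weight L s := \sum_i (L i (s i) : nat).

Definition regular lam L :=
  (forall i, \sum_j (L i j : nat) = lam) /\ (forall j, \sum_i (L i j : nat) = lam).

(** For a frequency square, the block pattern of [A_square] with rows and columns in any order,
    without naming the permutations. *)
Definition agreement L := exists r c : pred T, forall i j, L i j = (r i == c j).

Lemma weight_tperm L s i j : i != j ->
  weight L (tperm i j * s)%g + L i (s i) + L j (s j) =
  weight L s + L i (s j) + L j (s i).
Proof.
move=> ij; have ji : j != i by rewrite eq_sym.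
rewrite /weight (bigD1 i) //= (bigD1 j) //=.
rewrite [in RHS](bigD1 i) // [in RHS](bigD1 j) //=.
rewrite !permM tpermL tpermR.
have -> : \sum_(k | (k != i) && (k != j)) L k ((tperm i j * s)%g k)
        = \sum_(k | (k != i) && (k != j)) L k (s k).
  by apply: eq_bigr => k /andP[ki kj]; rewrite permM tpermD // eq_sym.
lia.
Qed.

Lemma weight_col_perm L s u :
  weight (fun i j => L i (u j)) s = weight L (s * u)%g.
Proof. by apply: eq_bigr => i _; rewrite permM. Qed.

Lemma regular_col_perm lam L u :
  regular lam L -> regular lam (fun i j => L i (u j)).
Proof.
case=> rL cL; split=> [i|j]; last exact: cL.
by rewrite -(rL i) [RHS](reindex_perm u).
Qed.

Lemma sum_negb (b : pred T) : \sum_i (~~ b i : nat) + \sum_i (b i : nat) = #|T|.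
Proof. by rewrite -big_split /= -sum1_card; apply: eq_bigr => i _; case: (b i). Qed.

Lemma weight_negb L s : weight (fun i j => ~~ L i j) s + weight L s = #|T|.
Proof. exact: (sum_negb (fun i => L i (s i))). Qed.

Lemma regular_negb lam L : #|T| = 2 * lam ->
  regular lam L -> regular lam (fun i j => ~~ L i j).
Proof.
move=> cT [rL cL]; split=> [i|j].
  by have := sum_negb (L i); rewrite rL cT; lia.
by have := sum_negb (L^~ j); rewrite cL cT; lia.
Qed.

(** * Local constraints when the identity has weight [lam - 1] *)

Definition unbalanced_low lam L :=
  [/\ regular lam L, forall s, weight L s != lam & weight L 1 + 1 = lam].

(** Composing the identity with [(i j)] adds [L i j + L j i] to the weight; a gain of exactly one
    would reach [lam]. *)
Lemma low_sym lam L i j : unbalanced_low lam L ->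
  ~~ L i i -> ~~ L j j -> L i j = L j i.
Proof.
case=> _ nb w1 /negbTE di /negbTE dj.
have [-> // | ij] := eqVneq i j.
have := weight_tperm L 1 ij; rewrite !perm1 mulg1 di dj.
have /eqP := nb (tperm i j); move: w1; move: (weight L 1) (weight _ _) => p q.
by case: (L i j); case: (L j i) => //=; lia.
Qed.

(** The gain is now [L i j + L j i - 1], so two ones would reach [lam]. *)
Lemma low_nand lam L i j : unbalanced_low lam L ->
  ~~ L i i -> L j j -> ~~ (L i j && L j i).
Proof.
case=> _ nb w1 /negbTE di dj.
have [ij|ij] := eqVneq i j; first by rewrite ij dj in di.
have := weight_tperm L 1 ij; rewrite !perm1 mulg1 di dj.
have /eqP := nb (tperm i j); move: w1; move: (weight L 1) (weight _ _) => p q.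
by case: (L i j); case: (L j i) => //=; lia.
Qed.

Definition flip a b L i j := ~~ L i (tperm a b j).

(** The transposition [(a b)] has weight [lam + 1], hence [lam - 1] in the complement; exchanging
    the columns moves it to the identity. So facts about [L] have duals read off from
    [flip a b L]. *)
Lemma flip_low lam L a b : #|T| = 2 * lam -> unbalanced_low lam L ->
  a != b -> ~~ L a a -> ~~ L b b -> L a b -> unbalanced_low lam (flip a b L).
Proof.
move=> cT lL ab da db Lab; have Lba : L b a by rewrite (low_sym lL).
case: lL => rL nb w1; split.
- exact: (regular_col_perm _ (regular_negb cT rL)).
- move=> s; rewrite (weight_col_perm (fun i j => ~~ L i j)).
  have := weight_negb L (s * tperm a b)%g; have := nb (s * tperm a b)%g.
  by rewrite cT; lia.
- rewrite (weight_col_perm (fun i j => ~~ L i j)) mul1g.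
  have := weight_negb L (tperm a b); have := weight_tperm L 1 ab.
  by rewrite !perm1 mulg1 (negbTE da) (negbTE db) Lab Lba cT; lia.
Qed.

(** * Structure forced by an edge *)

Section Edge.

Variables (lam : nat) (L : T -> T -> bool).
Hypotheses (cT : #|T| = 2 * lam) (lowL : unbalanced_low lam L).

(** By [low_sym], these are the pairs whose transposition lifts the weight from [lam - 1] to
    [lam + 1]. *)
Definition edge a b := [&& a != b, ~~ L a a, ~~ L b b & L a b].

Lemma edge_sym a b : edge a b -> edge b a.
Proof.
case/and4P=> ab da db Lab.
by rewrite /edge eq_sym ab da db (low_sym lowL).
Qed.

Lemma edge_flip a b : edge a b -> unbalanced_low lam (flip a b L).
Proof. by case/and4P=> *; apply: flip_low. Qed.

(** This is [low_nand] in the flipped array, where [a] has diagonal entry 0 and [k] has 1. *)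
Lemma edge_dominates a b k : edge a b -> k != a -> k != b -> ~~ L k k ->
  L a k || L b k.
Proof.
move=> eab ka kb dk; have lM := edge_flip eab.
case/and4P: eab => ab da db Lab.
have := low_nand (i := a) (j := k) lM.
rewrite /flip tpermL (tpermD _ _) 1?eq_sym // Lab dk => /(_ isT isT).
by rewrite (low_sym lowL db dk); case: (L a k); case: (L k b).
Qed.

(** This is [low_sym] in the flipped array, where [a] and [k] both have diagonal entry 0. *)
Lemma edge_one a b k : edge a b -> L k k -> L a k = L k b.
Proof.
move=> eab dk; have lM := edge_flip eab.
case/and4P: eab => ab da db Lab.
have ka : a != k by apply: contraNneq da => ->.
have kb : b != k by apply: contraNneq db => ->.
have := low_sym (i := a) (j := k) lM.
rewrite /flip tpermL (tpermD _ _) // Lab dk => /(_ isT isT).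
by move/negb_inj.
Qed.

(** Away from [a] and [b] the flip is plain complementation, so [low_nand] in the two arrays
    excludes two ones and two zeros. *)
Lemma edge_avoiding a b k l : edge a b -> k != a -> k != b ->
  ~~ L k k -> L l l -> L l k = ~~ L k l.
Proof.
move=> eab ka kb dk dl; have lM := edge_flip eab.
case/and4P: eab => ab da db Lab.
have la : a != l by apply: contraNneq da => ->.
have lb : b != l by apply: contraNneq db => ->.
have tl : tperm a b l = l by rewrite tpermD.
have tk : tperm a b k = k by rewrite tpermD // eq_sym.
have := low_nand (i := l) (j := k) lM.
rewrite /flip tl tk dl dk => /(_ isT isT).
have := low_nand lowL dk dl.
by case: (L k l); case: (L l k).
Qed.

(* The row and column of [a] together contain [2 lam] ones; cells on indices
   with diagonal entry 1 account for at most [lam - 1] of them. *)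
Lemma edge_extend a b l : edge a b -> L l l -> exists2 y, y != b & edge a y.
Proof.
move=> eab dl; case/and4P: (eab) => ab da db Lab.
have Lba : L b a by rewrite (low_sym lowL).
case: (lowL) => [[rL cL] _ w1].
have [/existsP[y /andP[]]|] := boolP [exists y, (y != b) && edge a y].
  by exists y.
rewrite negb_exists => /forallP noedge.
have w2 : 0 < weight L 1 by rewrite /weight (bigD1 l) //= perm1 dl.
(* Only [j = b] can contribute two. The sums would give [2 * lam <= (lam - 1) + 2], while [w2]
   forces [lam >= 2]. *)
have : \sum_j ((L a j : nat) + L j a) <= \sum_j ((L j j : nat) + (j == b) * 2).
  apply: leq_sum => j _.
  have [-> | jb] := eqVneq j b; first by case: (L a b); case: (L b a); lia.
  have [-> | ja] := eqVneq j a; first by rewrite (negbTE da).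
  have [dj | dj] := boolP (L j j).
    by have := low_nand lowL da dj; case: (L a j); case: (L j a).
  have := noedge j; rewrite jb /edge eq_sym ja da dj /= => nLaj.
  by rewrite (low_sym lowL dj da) (negbTE nLaj).
rewrite !big_split /= rL cL.
have -> : \sum_(j : T) (j == b) * 2 = 2.
  by rewrite (bigD1 b) //= eqxx big1 // => j /negbTE->.
have <- : weight L 1 = \sum_j L j j by apply: eq_bigr => j _; rewrite perm1.
by lia.
Qed.

(** If [k] is an end of the edge, [edge_extend] at the other end supplies an edge avoiding [k]. *)
Lemma zero_one_xor a b k l : edge a b -> ~~ L k k -> L l l -> L l k = ~~ L k l.
Proof.
move=> eab dk dl; have eba := edge_sym eab.
have [ka|ka] := eqVneq k a.
  have [y ya eby] := edge_extend eba dl.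
  case/and4P: (eab) => ab _ _ _.
  by apply: (edge_avoiding eby) => //; rewrite ka // eq_sym.
have [kb|kb] := eqVneq k b.
  have [y yb eay] := edge_extend eab dl.
  case/and4P: (eab) => ab _ _ _.
  by apply: (edge_avoiding eay) => //; rewrite kb eq_sym.
exact: (edge_avoiding eab).
Qed.

Lemma edge_one_compl a b k : edge a b -> L k k -> L b k = ~~ L a k.
Proof.
move=> eab dk; case/and4P: (eab) => _ _ db _.
by rewrite (edge_one eab dk) (zero_one_xor eab db dk) negbK.
Qed.

Lemma edge_compl a b k : edge a b -> L b k = ~~ L a k.
Proof.
move=> eab; have [dk|dk] := boolP (L k k); first exact: edge_one_compl.
case/and4P: (edge_sym eab) => _ db da Lba.
case/and4P: (eab) => ab _ _ Lab.
have [->|ka] := eqVneq k a; first by rewrite Lba (negbTE da).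
have [->|kb] := eqVneq k b; first by rewrite Lab (negbTE db).
have := edge_dominates eab ka kb dk.
case Lak: (L a k); case Lbk: (L b k) => // _.
(* Now [a], [b], [k] form a triangle of edges, so a column [l] with [L l l] would hold three
   pairwise different booleans. *)
have eak : edge a k by rewrite /edge eq_sym ka da dk.
have ebk : edge b k by rewrite /edge eq_sym kb db dk.
(* Without such an [l], [lam] would be 1 and [T] too small for three elements. *)
have [l dl] : exists l, L l l.
  apply/existsP; apply: contraT; rewrite negb_exists => /forallP d0.
  have w0 : weight L 1 = 0 by apply: big1 => i _; rewrite perm1 (negbTE (d0 i)).
  case: lowL => _ _; rewrite w0 => l1.
  have : #|k |: [set a; b]| <= #|T| by exact: max_card.
  by rewrite cT cardsU1 !inE cards2 ab (negbTE ka) (negbTE kb) -l1.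
have := edge_one_compl eab dl; have := edge_one_compl eak dl.
by have := edge_one_compl ebk dl; case: (L a l); case: (L b l); case: (L k l).
Qed.

(** For [k] other than [a], there is an edge from [k] to [a] if [L a k] and to [b] otherwise;
    [edge_compl] then compares row [k] with row [a]. *)
Lemma zero_row a b k j : edge a b -> ~~ L k k -> L k j = L a k (+) L a j.
Proof.
move=> eab dk; case/and4P: (eab) => ab da db Lab.
have [->|ka] := eqVneq k a; first by rewrite (negbTE da).
have [Lak|Lak] := boolP (L a k).
  by rewrite (@edge_compl a k) // /edge eq_sym ka da dk.
have Lbk : L b k by rewrite (edge_compl _ eab).
have kb : k != b by apply: contraNneq Lak => ->.
rewrite (@edge_compl b k) ?(edge_compl _ eab) ?negbK //.
by rewrite /edge eq_sym kb db dk.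
Qed.

End Edge.

Lemma low_edge_agreement lam L a b : #|T| = 2 * lam -> unbalanced_low lam L ->
  edge L a b -> agreement L.
Proof.
move=> cT lL eab; exists (fun i => ~~ L i a), (L a) => i j.
have lM := edge_flip cT lL eab.
case/and4P: (eab) => ab da db Lab.
suff Lij : L i j = L i a (+) L a j by rewrite Lij; case: (L i a); case: (L a j).
(* A row with diagonal entry 1 in [L] has 0 in the flipped array, so [zero_row] covers every row
   through one of the two arrays. *)
have [di|di] := boolP (L i i); last first.
  by rewrite !(zero_row cT lL _ eab di) (negbTE da) addbF.
have ia : a != i by apply: contraNneq da => ->.
have ib : b != i by apply: contraNneq db => ->.
have eM : edge (flip a b L) a b.
  by rewrite /edge ab /flip tpermL tpermR Lab (low_sym lL db da) Lab da.
have dM : ~~ flip a b L i i by rewrite /flip tpermD // negbK.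
have row k : L i k = ~~ (L a i (+) L a k).
  have := zero_row cT lM (tperm a b k) eM dM; rewrite /flip tpermK tpermD //.
  by case: (L i k); case: (L a i); case: (L a k).
by rewrite !row (negbTE da); case: (L a i); case: (L a j).
Qed.

(** * Reduction of unbalanced arrays to the low case *)

Lemma crossing lam L s u : (forall v, weight L v != lam) ->
  weight L s < lam -> lam < weight L u ->
  exists v a b, [/\ a != b, weight L v + 1 = lam &
    weight L (tperm a b * v)%g = lam + 1].
Proof.
(* Walk from [s] to [u] by transpositions: each changes the weight by at most 2, so passing [lam]
   takes a jump from [lam - 1] to [lam + 1]. *)
move=> nb ls; have [ts tsE tsN] := prod_tpermP (u * s^-1)%g.
have -> : u = (\prod_(t <- ts) tperm t.1 t.2 * s)%g by rewrite -tsE mulgKV.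
elim: ts tsN {tsE} => [_|[a b] ts IH /= /andP[ab /IH{}IH]].
  by rewrite big_nil mul1g; lia.
rewrite big_cons -mulgA /=; set v := (_ * s)%g => lu.
have [lv|] := ltnP lam (weight L v); first exact: IH.
rewrite leq_eqVlt (negbTE (nb v)) /= => vl.
have step : weight L (tperm a b * v)%g <= weight L v + 2.
  have := weight_tperm L v ab.
  by case: (L a (v a)); case: (L b (v b)); case: (L a (v b)); case: (L b (v a)); lia.
have {}lu : lam < weight L (tperm a b * v)%g := lu.
by exists v, a, b; split=> //; lia.
Qed.

(** Permuting columns turns the [v] of [crossing] into the identity, and the gain of two makes [a],
    [b] an edge. *)
Lemma unbalanced_agreement lam L s u : #|T| = 2 * lam -> regular lam L ->
  (forall v, weight L v != lam) -> weight L s < lam -> lam < weight L u ->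
  agreement L.
Proof.
move=> cT rL nb ls lu; have [v [a [b [ab wv wt]]]] := crossing nb ls lu.
pose M i j := L i (v j).
have lM : unbalanced_low lam M.
  split; first exact: regular_col_perm.
    by move=> w; rewrite weight_col_perm.
  by rewrite weight_col_perm mul1g.
have eM : edge M a b.
  have := weight_tperm L v ab; rewrite /edge ab /M; move: wv wt.
  move: (weight L v) (weight L _) => p q.
  by case: (L a (v a)); case: (L b (v b)); case: (L a (v b)); case: (L b (v a)); lia.
have [r [c Mrc]] := low_edge_agreement cT lM eM.
exists r, (fun j => c ((v^-1)%g j)) => i j.
by rewrite -Mrc /M permKV.
Qed.

(** * Class sizes and parity in agreement form *)

Lemma agreement_card lam L (r c : pred T) : 0 < lam -> #|T| = 2 * lam ->
  regular lam L -> (forall i j, L i j = (r i == c j)) ->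
  \sum_i (r i : nat) = lam /\ \sum_j (c j : nat) = lam.
Proof.
move=> l0 cT [rL cL] Lrc.
have [x _] : exists x : T, x \in T by apply/card_gt0P; rewrite cT; lia.
have half (b : pred T) e : \sum_i (b i == e : nat) = lam -> \sum_i (b i : nat) = lam.
  case: e => [<-|be]; first by apply: eq_bigr => i _; rewrite eqb_id.
  have : \sum_i (~~ b i : nat) = lam.
    by rewrite -be; apply: eq_bigr => i _; rewrite eqbF_neg.
  by have := sum_negb b; rewrite cT; lia.
split; [apply: (half r (c x)) | apply: (half c (r x))].
  by rewrite -(cL x); apply: eq_bigr => i _; rewrite Lrc.
by rewrite -(rL x); apply: eq_bigr => j _; rewrite Lrc eq_sym.
Qed.

(** Sum the identity [(r == c) + r + c = 1 + 2 * (r && c)] over the cells [(i, s i)]; both classes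
    have size [lam], so the terms [2 * lam] cancel. *)
Lemma agreement_weight_even lam L s : 0 < lam -> #|T| = 2 * lam ->
  regular lam L -> agreement L -> ~~ odd (weight L s).
Proof.
move=> l0 cT rL [r [c Lrc]].
have [sr] := agreement_card l0 cT rL Lrc; rewrite (reindex_perm s) => sc.
have : weight L s + \sum_i (r i : nat) + \sum_i (c (s i) : nat) =
       #|T| + 2 * \sum_i (r i && c (s i) : nat).
  rewrite /weight -!big_split /= -sum1_card big_distrr -big_split /=.
  by apply: eq_bigr => i _; rewrite Lrc; case: (r i); case: (c (s i)).
rewrite sr sc cT; lia.
Qed.

End Weight.

(** The cyclic shifts [i + k] partition the cells, so their weights average to [lam]; as none equals
    [lam], some lie on each side. *)
Lemma weight_straddle n lam (L : 'I_n -> 'I_n -> bool) : 0 < n ->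
  regular lam L -> (forall s, weight L s != lam) ->
  exists s u, weight L s < lam < weight L u.
Proof.
case: n L => // n L _ [rL _] nb.
pose shift (k : 'I_n.+1) := perm (@GRing.addIr _ k).
have tot : \sum_k weight L (shift k) = \sum_(k < n.+1) lam.
  rewrite exchange_big /=; apply: eq_bigr => i _; rewrite -(rL i).
  rewrite [RHS](reindex_inj (@GRing.addrI _ i)).
  by apply: eq_bigr => k _; rewrite permE.
have [/existsP[k lk]|] := boolP [exists k, weight L (shift k) < lam]; last first.
  rewrite negb_exists => /forallP ge.
  have : \sum_(k < n.+1) lam.+1 <= \sum_k weight L (shift k).
    by apply: leq_sum => k _; rewrite ltn_neqAle eq_sym nb leqNgt ge.
  by rewrite tot !sum_nat_const card_ord; nia.
have [/existsP[m lm]|] := boolP [exists k, lam < weight L (shift k)].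
  by exists (shift k), (shift m); rewrite lk.
rewrite negb_exists => /forallP le.
have : \sum_k (weight L (shift k)).+1 <= \sum_(k < n.+1) lam.
  by apply: leq_sum => m _; rewrite ltn_neqAle nb leqNgt le.
under eq_bigr do rewrite -addn1.
by rewrite big_split /= tot !sum_nat_const card_ord; nia.
Qed.

(** * Translation to frequency squares, diagonals and equivalence *)

Definition ones n (L : 'M[symbol]_n) i j := L i j == sym1.

Lemma symbol_cases (k : symbol) : k = sym1 \/ k = sym2.
Proof. by case: k => [[|[|//]] lt]; [left | right]; apply: val_inj. Qed.

Lemma neq_sym1 (k : symbol) : (k == sym2) = (k != sym1).
Proof. by case: (symbol_cases k) => ->. Qed.

Lemma frequency_square_regular lam (L : 'M[symbol]_(2 * lam)) :
  frequency_square L -> regular lam (ones L).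
Proof.
move=> /(_ sym1)[rL cL]; split=> [i|j]; [rewrite -[RHS](rL i) | rewrite -[RHS](cL j)].
  by rewrite -sum1dep_card [RHS]big_mkcond /=; apply: eq_bigr => j _; rewrite /ones; case: eqP.
by rewrite -sum1dep_card [RHS]big_mkcond /=; apply: eq_bigr => i _; rewrite /ones; case: eqP.
Qed.

Definition graph n (s : 'S_n) : {set 'I_n * 'I_n} := [set (i, s i) | i : 'I_n].

Lemma mem_graph n (s : 'S_n) i j : ((i, j) \in graph s) = (s i == j).
Proof.
apply/imsetP/eqP => [[k _ [-> ->]] // | <-].
by exists i.
Qed.

Lemma diagonal_graph n (s : 'S_n) : diagonal (graph s).
Proof.
split=> [i|j]; apply/eqP/cards1P.
  exists (i, s i); apply/setP=> -[k l]; rewrite !inE mem_graph xpair_eqE /=.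
  by apply/andP/andP=> [[/eqP<- /eqP->] | [/eqP-> /eqP->]].
exists ((s^-1)%g j, j); apply/setP=> -[k l]; rewrite !inE mem_graph xpair_eqE /=.
by apply/andP/andP=> [[/eqP<- /eqP<-] | [/eqP-> /eqP->]]; rewrite ?permK ?permKV ?eqxx.
Qed.

(** One cell per row makes [D] the graph of a function; one per column makes it injective. *)
Lemma diagonalP n (D : {set 'I_n * 'I_n}) :
  diagonal D -> exists s : 'S_n, D = graph s.
Proof.
case=> rD cD.
have ex i : exists c, [set x in D | x.1 == i] = [set c] by apply/cards1P; rewrite rD.
pose f i := (xchoose (P := fun c => [set x in D | x.1 == i] == [set c])
  (let: ex_intro c e := ex i in ex_intro _ c (introT eqP e))).2.
have fP i j : ((i, j) \in D) = (f i == j).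
  rewrite /f; set e := (e in xchoose e); have /eqP := xchooseP e.
  case: (xchoose e) => k l /setP E /=.
  have := E (k, l); rewrite !inE eqxx /= => /andP[_ /eqP ki].
  by have := E (i, j); rewrite !inE /= eqxx andbT xpair_eqE ki eqxx /= eq_sym.
have f_inj : injective f.
  move=> i k fik; have /eqP/cards1P[c /setP E] := cD (f i).
  have := E (i, f i); have := E (k, f i); rewrite !inE !fP fik !eqxx /=.
  by move=> /esym/eqP<- /esym/eqP[].
exists (perm f_inj); apply/setP=> -[i j].
by rewrite mem_graph permE fP.
Qed.

Lemma graph_ones lam (L : 'M[symbol]_(2 * lam)) s :
  balanced L (graph s) <-> weight (ones L) s = lam.
Proof.
have cnt k : #|[set c in graph s | L c.1 c.2 == k]| = \sum_i (L i (s i) == k).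
  have -> : [set c in graph s | L c.1 c.2 == k] =
            [set (i, s i) | i in [set i | L i (s i) == k]].
    apply/setP=> -[i j]; rewrite !inE mem_graph.
    apply/andP/imsetP => /= [[/eqP <- Lk] | [m + [-> ->]]]; rewrite ?inE //.
    by exists i; rewrite ?inE.
  rewrite card_imset => [|i j [] //]; rewrite -sum1dep_card big_mkcond.
  by apply: eq_bigr => i _; case: (_ == k).
split=> [/(_ sym1)|w k]; rewrite cnt //.
case: (symbol_cases k) => -> //.
under eq_bigr do rewrite neq_sym1.
have : \sum_i (L i (s i) != sym1) + weight (ones L) s = #|'I_(2 * lam)|.
  exact: weight_negb.
by rewrite w card_ord; lia.
Qed.

Lemma has_balanced_diagonalP lam (L : 'M[symbol]_(2 * lam)) :
  has_balanced_diagonal L <-> exists s, weight (ones L) s = lam.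
Proof.
split=> [[D [/diagonalP[s ->] /graph_ones]] | [s /graph_ones b]].
  by exists s.
by exists (graph s); split=> //; apply: diagonal_graph.
Qed.

Lemma exists_perm_threshold n lam (r : pred 'I_n) :
  lam <= n -> \sum_i (r i : nat) = lam -> exists s : 'S_n, forall i, r (s i) = (i < lam).
Proof.
move=> ln sr.
pose t := [tuple r i | i < n]; pose v := [tuple (i : nat) < lam | i < n].
suff /tuple_permP[s E] : perm_eq v t.
  exists s => i; have vt : v = [tuple tnth t (s i) | i < n] by apply: val_inj.
  by have := congr1 (fun x => tnth x i) vt; rewrite !tnth_mktuple.
have cr : count id t = lam.
  by rewrite -sr /= count_map -sum1_count big_mkcond /= big_enum /=; apply: eq_bigr => i _; case: (r i).
have cv : count id v = lam.
  rewrite /= count_map -sum1_count big_mkcond /= big_enum /= -big_mkcond /=.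
  by rewrite (big_ord_narrow ln) sum1_card card_ord.
(* Boolean sequences of equal length with equally many [true] entries are rearrangements of each
   other. *)
have bool_count (e : seq bool) a : count a e = a true * count id e + a false * (size e - count id e).
  elim: e => [|x e IH] /=; first by rewrite !muln0.
  rewrite IH; have := count_size id e.
  by case: x; case: (a true); case: (a false) => /=; lia.
by apply/seq.permP=> a; rewrite bool_count [RHS]bool_count cr cv !size_tuple.
Qed.

Lemma agreement_equivalent lam (L : 'M[symbol]_(2 * lam)) : 0 < lam ->
  regular lam (ones L) -> agreement (ones L) -> equivalent L (A_square lam).
Proof.
move=> l0 rL [r [c Lrc]].
have ln : lam <= 2 * lam by lia.
have [] := agreement_card l0 (card_ord _) rL Lrc.
move=> /(exists_perm_threshold ln)[s rs] /(exists_perm_threshold ln)[u cu].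
have -> : A_square lam = row_perm s (col_perm u L).
  apply/matrixP=> i j; rewrite !mxE -rs -cu -Lrc /ones.
  by case: (symbol_cases (L (s i) (u j))) => ->.
exact/equivalent_rows/equivalent_cols/equivalent_refl.
Qed.

(** Permutations act on [r] or [c], transposing swaps them, and exchanging the symbols negates
    [c]. *)
Lemma equivalent_agreement n (L M : 'M[symbol]_n) :
  equivalent L M -> agreement (ones M) -> agreement (ones L).
Proof.
elim=> [//|{}M s _ IH|{}M s _ IH|{}M s _ IH|{}M _ IH] [r [c E]]; apply: IH.
- exists (fun i => r ((s^-1)%g i)), c => i j.
  by rewrite -E /ones mxE permKV.
- exists r, (fun j => c ((s^-1)%g j)) => i j.
  by rewrite -E /ones mxE permKV.
- have [s1 | s1] := symbol_cases (s sym1).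
    exists r, c => i j; rewrite -E /ones mxE -{2}s1.
    by rewrite (inj_eq perm_inj).
  exists r, (fun j => ~~ c j) => i j.
  have := E i j; rewrite /ones mxE => {}E.
  have -> : (M i j == sym1) = ~~ (s (M i j) == sym1).
    by rewrite -neq_sym1 -s1 (inj_eq perm_inj).
  by rewrite E; case: (r i); case: (c j).
- exists c, r => i j; have := E j i; rewrite /ones mxE => ->.
  by rewrite eq_sym.
Qed.

Lemma A_square_agreement lam : agreement (ones (A_square lam)).
Proof.
exists (fun i : 'I__ => i < lam), (fun j : 'I__ => j < lam) => i j.
by rewrite /ones mxE; case: ifP.
Qed.

Theorem theorem2 (lam : nat) (hlam : 1 <= lam) (L : 'M[symbol]_(2 * lam))
    (hL : frequency_square L) :
  has_balanced_diagonal L <-> ~ (odd lam /\ equivalent L (A_square lam)).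
Proof.
have rL := frequency_square_regular hL.
have cT : #|'I_(2 * lam)| = 2 * lam := card_ord _.
split=> [/has_balanced_diagonalP[s ws] [oddl eqv] | nA].
  have aL := equivalent_agreement eqv (A_square_agreement lam).
  by have := agreement_weight_even s hlam cT rL aL; rewrite ws oddl.
apply/has_balanced_diagonalP.
have [/existsP[s /eqP ws]|] := boolP [exists s, weight (ones L) s == lam].
  by exists s.
rewrite negb_exists => /forallP nb; case: nA.
have n0 : 0 < 2 * lam by lia.
have [s [u /andP[ls lu]]] := weight_straddle n0 rL nb.
have aL := unbalanced_agreement cT rL nb ls lu.
split; last exact: agreement_equivalent.
(* The weight [lam - 1] of [v] is even, so [lam] is odd. *)
have [v [a [b [_ wv _]]]] := crossing nb ls lu.
by have := agreement_weight_even v hlam cT rL aL; lia.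
Qed.
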